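(* There is a constant $C>0$ such that for every integer $n\ge 2$ there exists a quantum circuit acting on $n$ control qubits, one target qubit and $2$ clean ancilla qubits, consisting of Toffoli gates and Clifford gates, that implements the $n$-controlled NOT gate $$|c_1,\dots,c_n\rangle\,|t\rangle \mapsto |c_1,\dots,c_n\rangle\,|t\oplus (c_1\wedge\cdots\wedge c_n)\rangle ,\qquad c_i,t\in\{0,1\},$$ (extended linearly), uses $2n-3$ Toffoli gates, and has depth at most $C\log_2 n$.
   Context: A Toffoli gate with controls $x,y$ and target $z$ (three distinct qubits) maps $|x,y,z\rangle\mapsto|x,y,z\oplus (x\wedge y)\rangle$. A clean ancilla qubit is a qubit that is guaranteed to be in state $|0\rangle$ at the start of the circuit and must be returned to $|0\rangle$ at the end, for every input on the other qubits. The depth of a circuit is the minimum number of layers into which its gates can be arranged so that gates in the same layer act on disjoint sets of qubits and the order of gates sharing a qubit is respected. The Toffoli count counts every Toffoli gate of the circuit, both in computation and in uncomputation. *)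

(* Defs.v *)
From HB Require Import structures.
From mathcomp Require Import all_boot all_order all_fingroup all_algebra.
From mathcomp Require Import complex.
From mathcomp Require Import reals exp.

Set Implicit Arguments.
Unset Strict Implicit.
Unset Printing Implicit Defensive.

Import Order.TTheory GRing.Theory Num.Theory.
Local Open Scope ring_scope.

(* The qubits of a register are the elements of an arbitrary finite type Q. *)
Notation basis Q := {ffun Q -> bool}.

(* (C^2)^{\otimes Q}: a vector is the family of its amplitudes; R[i] is C. *)
Notation state R Q := {ffun basis Q -> R[i]}.

Definition ket (R : realType) (Q : finType) (x : basis Q) : state R Q :=
  [ffun y => (y == x)%:R].

Definition lin_ext (R : realType) (P Q : finType)
    (f : basis P -> state R Q) (psi : state R P) : state R Q :=
  \sum_(x : basis P) psi x *: f x.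

Definition upd (Q : finType) (x : basis Q) (q : Q) (b : bool) : basis Q :=
  [ffun p => if p == q then b else x p].

(* The Clifford group is generated, up to global phase, by H, S and CNOT; the
   Clifford gates available to a circuit are these together with the other
   usual one- and two-qubit ones.  Since the listed gates act on at most two
   qubits, large Clifford operators do not count as a single gate.
   The last argument of CNOT and Toffoli is the target. *)
Inductive gate (Q : Type) : Type :=
  | GateX of Q
  | GateY of Q
  | GateZ of Q
  | GateH of Q
  | GateS of Q
  | GateSdg of Q
  | GateCNOT of Q & Q
  | GateCZ of Q & Q
  | GateSWAP of Q & Q
  | GateToffoli of Q & Q & Q.

Definition wires (Q : Type) (g : gate Q) : seq Q :=
  match g with
  | GateX q | GateY q | GateZ q | GateH q | GateS q | GateSdg q => [:: q]
  | GateCNOT p q | GateCZ p q | GateSWAP p q => [:: p; q]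
  | GateToffoli p q r => [:: p; q; r]
  end.

Definition is_toffoli (Q : Type) (g : gate Q) : bool :=
  if g is GateToffoli _ _ _ then true else false.

Definition gate_ket (R : realType) (Q : finType) (g : gate Q) (x : basis Q) :
    state R Q :=
  match g with
  | GateX q => ket R (upd x q (~~ x q))
  | GateY q => ('i * (-1) ^+ x q) *: ket R (upd x q (~~ x q))
  | GateZ q => (-1) ^+ x q *: ket R x
  | GateH q => (sqrtC 2)^-1 *:
      (ket R (upd x q false) + (-1) ^+ x q *: ket R (upd x q true))
  | GateS q => 'i ^+ x q *: ket R x
  | GateSdg q => (- 'i) ^+ x q *: ket R x
  | GateCNOT p q => ket R (upd x q (x q (+) x p))
  | GateCZ p q => (-1) ^+ (x p && x q) *: ket R x
  | GateSWAP p q => ket R [ffun r => x (tperm p q r)]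
  | GateToffoli p q r => ket R (upd x r (x r (+) (x p && x q)))
  end.

Definition gate_op (R : realType) (Q : finType) (g : gate Q) :
    state R Q -> state R Q := lin_ext (gate_ket R g).

(* The head of the list is the gate applied first. *)
Notation circuit Q := (seq (gate Q)).

Definition circuit_op (R : realType) (Q : finType) (c : circuit Q)
    (psi : state R Q) : state R Q :=
  foldl (fun phi g => gate_op g phi) psi c.

(* Every gate acts on pairwise distinct qubits. *)
Definition well_formed (Q : finType) (c : circuit Q) : bool :=
  all (fun g => uniq (wires g)) c.

Definition toffoli_count (Q : Type) (c : circuit Q) : nat :=
  count (@is_toffoli Q) c.

Definition share_qubit (Q : finType) (g h : gate Q) : bool :=
  has [in wires g] (wires h).

(* l assigns a layer to each gate position.  The strict inequality says both
   that gates sharing a qubit lie in different layers and that their order is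
   kept. *)
Definition is_layering (Q : finType) (c : circuit Q) (d : nat)
    (l : {ffun 'I_(size c) -> 'I_d}) : bool :=
  [forall i : 'I_(size c), forall j : 'I_(size c),
    ((i < j)%N && share_qubit (tnth (in_tuple c) i) (tnth (in_tuple c) j))
      ==> (l i < l j)%N].

Definition has_layering (Q : finType) (c : circuit Q) (d : nat) : bool :=
  [exists l : {ffun 'I_(size c) -> 'I_d}, is_layering l].

Lemma ex_layering (Q : finType) (c : circuit Q) : exists d, has_layering c d.
Proof.
exists (size c); apply/existsP; exists [ffun i => i].
by apply/forallP=> i; apply/forallP=> j; rewrite !ffunE; apply/implyP=> /andP[].
Qed.

Definition depth (Q : finType) (c : circuit Q) : nat := ex_minn (ex_layering c).

(* |x> |-> |x>|0,...,0>, with A the ancilla qubits *)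
Definition add_clean (R : realType) (Q A : finType) :
    state R Q -> state R (Q + A)%type :=
  lin_ext (fun x : basis Q =>
    ket R [ffun q : Q + A => if q is inl p then x p else false]).

Definition implements_with_clean (R : realType) (Q A : finType)
    (c : circuit (Q + A)%type) (U : state R Q -> state R Q) : Prop :=
  forall psi : state R Q,
    circuit_op c (add_clean A psi) = add_clean A (U psi).

(* The controls are the qubits inl i and the target is inr tt. *)
Definition mcx (R : realType) (n : nat) :
    state R ('I_n + unit)%type -> state R ('I_n + unit)%type :=
  lin_ext (fun x : basis ('I_n + unit)%type =>
    ket R (upd x (inr tt) (x (inr tt) (+) [forall i : 'I_n, x (inl i)]))).

Definition log2 (R : realType) (x : R) : R := ln x / ln 2.

(* Main.v *)
Require Import Defs.
From HB Require Import structures.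
From mathcomp Require Import all_boot all_order all_fingroup all_algebra.
From mathcomp Require Import complex.
From mathcomp Require Import reals exp.
From mathcomp Require Import zify lra.

(* It suffices to find a circuit V of n - 2 Toffoli gates and NOT gates after
   which two qubits a, w hold values whose conjunction is that of the controls:
   then V, a Toffoli gate onto the target, and V reversed implement the gate, and
   restore the ancillas.

   V uses conditionally clean qubits.  A level with k clean bits combines k + 1
   controls into one bit a by a balanced tree of k Toffoli gates.  When a = 1,
   all the other 2k qubits of the tree are known to be 1, so after NOT gates they
   are clean under this condition and serve the next level, which computes the
   conjunction w of the remaining controls.  One clean bit is set aside to hold
   a /\ w; at the top level both ancillas are used and a, w are the two bits
   wanted.  The number of clean bits grows geometrically, so there are O(log n)
   levels.  They need not wait for each other: the leaves of a tree become
   available after its first layer, in the order in which the next tree needs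
   them, so each level adds O(1) layers to the depth. *)

Set Implicit Arguments.
Unset Strict Implicit.
Unset Printing Implicit Defensive.

Import Order.TTheory GRing.Theory Num.Theory.
Local Open Scope ring_scope.

(** * Classical circuits *)

Section Classical.
Local Open Scope nat_scope.
Variable Q : finType.
Implicit Types (g : gate Q) (c : circuit Q) (x : basis Q) (S : seq Q).

Definition classical g : bool :=
  match g with GateX _ | GateToffoli _ _ _ => true | _ => false end.

Definition act g x : basis Q :=
  match g with
  | GateX q => upd x q (~~ x q)
  | GateToffoli p q r => upd x r (x r (+) (x p && x q))
  | _ => x
  end.

Definition run c x : basis Q := foldl (fun y g => act g y) x c.

Lemma run_cat c d x : run (c ++ d) x = run d (run c x).
Proof. exact: foldl_cat. Qed.

Definition supported S c : bool := all (fun g => all [in S] (wires g)) c.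

Lemma well_formed_cat c d :
  well_formed (c ++ d) = well_formed c && well_formed d.
Proof. exact: all_cat. Qed.

Lemma toffoli_count_cat c d :
  toffoli_count (c ++ d) = toffoli_count c + toffoli_count d.
Proof. exact: count_cat. Qed.

Lemma supported_cat S c d : supported S (c ++ d) = supported S c && supported S d.
Proof. exact: all_cat. Qed.

Lemma sub_supported S T c : {subset S <= T} -> supported S c -> supported T c.
Proof. by move=> sST; apply: sub_all => g; apply: sub_all => q; apply: sST. Qed.

Lemma act_out g x q : q \notin wires g -> act g x q = x q.
Proof.
case: g => //= [p|p r s]; rewrite !inE !ffunE; first by move/negPf->.
by case/norP=> _ /norP[_ /negPf->].
Qed.

Lemma run_out S c x q : supported S c -> q \notin S -> run c x q = x q.
Proof.
move=> + qS; elim: c x => //= g c IH x /andP[/allP gS cS].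
by rewrite IH // act_out //; apply: contra qS => /gS.
Qed.

Lemma actK g x : uniq (wires g) -> classical g -> act g (act g x) = x.
Proof.
case: g => //= [q|p q r] U _; apply/ffunP=> s; rewrite !ffunE.
  by case: (s =P q) => [->|//]; rewrite eqxx negbK.
move: U; rewrite /= !inE !andbT => /andP[/norP[_ /negPf->] /negPf->].
by case: (s =P r) => [->|//]; rewrite eqxx addbK.
Qed.

Lemma run_revK c x :
  well_formed c -> all classical c -> run (rev c) (run c x) = x.
Proof.
elim: c x => //= g c IH x /andP[gU cU] /andP[gC cC].
by rewrite rev_cons -cats1 run_cat IH //= actK.
Qed.

Lemma act_upd g x q b :
  q \notin wires g -> act g (upd x q b) = upd (act g x) q b.
Proof.
case: g => [p|p|p|p|p|p|p r|p r|p r|p r s] //=; rewrite !inE => qg.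
  apply/ffunP=> s; rewrite !ffunE (eq_sym p) (negPf qg).
  by case: (s =P p) => [->|//]; rewrite (eq_sym p) (negPf qg).
have [/negPf qp /norP[/negPf qr /negPf qs]] := norP qg.
apply/ffunP=> u; rewrite !ffunE (eq_sym p) (eq_sym r) (eq_sym s) qp qr qs.
by case: (u =P s) => [->|//]; rewrite (eq_sym s) qs.
Qed.

(** In the final circuit this moves the flip of the target back before [c], so that [rev c] cancels
    [c] exactly. *)
Lemma run_upd S c x q b :
  supported S c -> q \notin S -> run c (upd x q b) = upd (run c x) q b.
Proof.
move=> + qS; elim: c x => //= g c IH x /andP[/allP gS cS]; rewrite -IH //.
by rewrite act_upd //; apply: contra qS => /gS.
Qed.

(** * Depth *)

(* Greedy schedule: [t q] is the number of the last layer in which [q] has been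
   used, and a gate goes into the first layer after that of all its qubits. *)
Definition gate_time g (t : Q -> nat) : nat := (\max_(q <- wires g) t q).+1.

Definition sched g (t : Q -> nat) : Q -> nat :=
  fun q => if q \in wires g then gate_time g t else t q.

Definition time c (t : Q -> nat) : Q -> nat := foldl (fun u g => sched g u) t c.

Lemma time_cat c d t : time (c ++ d) t = time d (time c t).
Proof. exact: foldl_cat. Qed.

Lemma time_out S c t q : supported S c -> q \notin S -> time c t q = t q.
Proof.
move=> + qS; elim: c t => //= g c IH t /andP[/allP gS cS].
by rewrite IH // /sched ifN //; apply: contra qS => /gS.
Qed.

Lemma lt_gate_time g t q : q \in wires g -> t q < gate_time g t.
Proof. by move=> qg; rewrite ltnS (leq_bigmax_seq (F := t)). Qed.

Lemma leq_time c t q : t q <= time c t q.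
Proof.
elim: c t => //= g c IH t; apply: leq_trans (IH _).
by rewrite /sched; case: ifP => // /lt_gate_time /ltnW.
Qed.

(** Layers become functions on [nat], free of ordinals depending on [size c], so that layerings of
    concatenations and reversals can be given by formulas. *)
Lemma has_layeringP c D :
  (exists l : nat -> nat, (forall i, i < size c -> l i < D) /\
     (forall g0 i j, i < j < size c ->
        share_qubit (nth g0 c i) (nth g0 c j) -> l i < l j)) <->
  has_layering c D.
Proof.
split=> [[l [lD lo]]|/existsP[l /forallP lP]].
  apply/existsP; exists [ffun i : 'I_(size c) => Ordinal (lD i (ltn_ord i))].
  apply/forallP=> i; apply/forallP=> j; apply/implyP=> /andP[ij].
  have g0 := tnth (in_tuple c) i.
  by rewrite !ffunE !(tnth_nth g0) /= => /lo; apply; rewrite ij /=.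
exists (fun i => if insub i is Some k then l k : nat else 0); split.
  by move=> i ic; rewrite insubT; apply: ltn_ord.
move=> g0 i j /andP[ij jc] sh; have ic := ltn_trans ij jc.
rewrite !insubT /=; have /forallP/(_ (Ordinal jc)) := lP (Ordinal ic).
by rewrite !(tnth_nth g0) /= ij sh.
Qed.

(** Layers are numbered from 0, so a gate of time [T] lies in layer [T - 1]. The interval for [l i]
    is the invariant that makes the induction work: a later gate on [q] starts no earlier than the
    time recorded for [q]. *)
Lemma greedy_layering c t :
  exists l : nat -> nat,
    (forall g0 i q, i < size c -> q \in wires (nth g0 c i) ->
       t q <= l i < time c t q) /\
    (forall g0 i j, i < j < size c ->
       share_qubit (nth g0 c i) (nth g0 c j) -> l i < l j).
Proof.
elim: c t => [|g c IH] t; first by exists id; split=> // g0 i j; rewrite andbF.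
have [l [lt lo]] := IH (sched g t).
exists (fun i => if i is i'.+1 then l i' else (gate_time g t).-1); split.
  move=> g0 [|i] q /=.
    move=> _ qg; rewrite -ltnS (lt_gate_time t qg) /=.
    by apply: leq_trans (leq_time _ _ _); rewrite /sched qg.
  rewrite ltnS => ic qi; have /andP[le ->] := lt _ _ _ ic qi; rewrite andbT.
  by apply: leq_trans le; apply: (leq_time [:: g]).
move=> g0 [|i] [|j] //=; rewrite ?ltnS; last exact: lo.
move=> jc /hasP[q qj qg]; have /andP[+ _] := lt _ _ _ jc qj.
by rewrite /sched qg.
Qed.

Lemma time_layering c D :
  (forall q, time c (fun=> 0) q <= D) -> has_layering c D.
Proof.
move=> tD; have [l [lt lo]] := greedy_layering c (fun=> 0).
apply/has_layeringP; exists l; split=> // i ic.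
have [g0 _]: exists g0 : gate Q, true by case: (c) ic => // g0; exists g0.
have [q qg]: exists q, q \in wires (nth g0 c i).
  by case: (nth _ _ _) => * /=; eexists; apply: mem_head.
by have /andP[_ h] := lt _ _ _ ic qg; apply: leq_trans h (tD q).
Qed.

Lemma has_layering_cat c d D E :
  has_layering c D -> has_layering d E -> has_layering (c ++ d) (D + E).
Proof.
move=> /has_layeringP[l [lD lo]] /has_layeringP[m [mE mo]].
apply/has_layeringP.
exists (fun i => if i < size c then l i else D + m (i - size c)); split.
  move=> i; rewrite size_cat => ic.
  case: (ltnP i (size c)) => h; first by rewrite ltn_addr ?lD.
  by rewrite ltn_add2l mE // ltn_subLR.
move=> g0 i j /andP[ij]; rewrite size_cat => jc; rewrite !nth_cat.
case: (ltnP j (size c)) => hj.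
  by rewrite (ltn_trans ij hj) => /lo; apply; rewrite ij.
case: (ltnP i (size c)) => hi; first by move=> _; rewrite ltn_addr ?lD.
move=> /mo; rewrite ltn_add2l; apply.
by rewrite ltn_subLR // subnKC // ij ltn_subLR.
Qed.

Lemma share_qubitC g h : share_qubit g h = share_qubit h g.
Proof. exact: has_sym. Qed.

Lemma has_layering_rev c D : has_layering c D -> has_layering (rev c) D.
Proof.
move=> /has_layeringP[l [lD lo]]; apply/has_layeringP.
(* The mirrored gate goes to the mirrored layer [D - 1 - l]. *)
exists (fun i => (D - l (size c - i.+1)).-1); split.
  by move=> i; rewrite size_rev => ic; have := lD (size c - i.+1); lia.
move=> g0 i j /andP[ij]; rewrite size_rev => jc.
have ic := ltn_trans ij jc; rewrite !nth_rev // share_qubitC => /lo h.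
have hi := lD (size c - i.+1); have := h; lia.
Qed.

Lemma depth_le c D : has_layering c D -> depth c <= D.
Proof. by rewrite /depth; case: ex_minnP => d _ /[apply]. Qed.

End Classical.

(** * Conjunctions with conditionally clean bits *)

Section AndCircuits.
Local Open Scope nat_scope.
Variable Q : finType.
Implicit Types (c : circuit Q) (x : basis Q) (P F : seq Q).

Record and_circuit P F c (w : Q) : Prop := AndCircuit {
  and_wf : well_formed c;
  and_classical : all (@classical Q) c;
  and_supported : supported (F ++ P) c;
  and_out : w \in F ++ P;
  and_count : toffoli_count c = (size F).-1;
  and_val : forall x, all (fun p => ~~ x p) P -> run c x w = all x F }.

(* The fresh bits form a queue: the two bits at the front are combined into the
   next clean bit, which then joins the back. *)
Fixpoint and_tree P F : circuit Q :=
  match P, F with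
  | p :: P', a :: b :: F' => GateToffoli a b p :: and_tree P' (rcons F' p)
  | _, _ => [::]
  end.

Lemma and_tree_supported P F : supported (F ++ P) (and_tree P F).
Proof.
elim: P F => [|p P IH] [|a [|b F]] //=; apply/andP; split.
  by rewrite !inE !mem_cat !inE !eqxx !orbT.
by apply: sub_supported (IH _) => q; rewrite cat_rcons !inE => ->; rewrite !orbT.
Qed.

Lemma and_tree_classical P F : all (@classical Q) (and_tree P F).
Proof. by elim: P F => [|p P IH] [|a [|b F]] /=. Qed.

Lemma and_tree_wf P F : uniq (F ++ P) -> well_formed (and_tree P F).
Proof.
elim: P F => [|p P IH] [|a [|b F]] //= /and3P[aF bF U].
rewrite IH ?cat_rcons // andbT !inE.
move: aF bF; rewrite !inE !mem_cat !inE !negb_or.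
by case/and4P=> -> _ -> _ /and3P[_ -> _].
Qed.

Lemma and_tree_count P F :
  size F = (size P).+1 -> toffoli_count (and_tree P F) = size P.
Proof.
rewrite /toffoli_count.
elim: P F => [|p P IH] [|a [|b F]] //= [sF].
by rewrite IH // size_rcons sF.
Qed.

(** Each gate replaces two bits of the queue by their conjunction, so the conjunction of the queue
    is invariant; the last bit left is the end of [F ++ P]. If all inputs are 1, every bit written
    is 1 as well, which makes the other bits conditionally clean after negation. *)
Lemma and_treeP P F d x :
  size F = (size P).+1 -> uniq (F ++ P) -> all (fun p => ~~ x p) P ->
  run (and_tree P F) x (last d (F ++ P)) = all x F /\
  (all x F -> all (run (and_tree P F) x) (F ++ P)).
Proof.
elim: P F d x => [|p P IH] [|a [|b F]] d x //=; first by rewrite !andbT.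
move=> [sF] /and3P[aF bF U] /andP[xp xP].
set y := upd _ _ _; rewrite -cat_rcons.
have sF' : size (rcons F p) = (size P).+1 by rewrite size_rcons sF.
move: aF bF U; rewrite inE negb_or -cat_rcons => /andP[ab aF] bF U.
have pP : p \notin F ++ P.
  by move: U; rewrite cat_rcons -cat1s uniq_catCA /= => /andP[].
have y_out v : v != p -> y v = x v by rewrite /y !ffunE => /negPf->.
have y_FP v : v \in F ++ P -> y v = x v.
  by move=> vFP; apply: y_out; apply: contraNneq pP => <-.
have yp : y p = x a && x b by rewrite /y ffunE eqxx (negPf xp).
have yP : all (fun p => ~~ y p) P.
  rewrite -(eq_in_all (a1 := fun q => ~~ x q)) // => v vP /=.
  by rewrite y_FP // mem_cat vP orbT.
have yF : all y (rcons F p) = [&& x a, x b & all x F].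
  rewrite all_rcons yp -andbA; do 2! congr (_ && _); apply: eq_in_all => v vF.
  by rewrite y_FP // mem_cat vF.
have [IH1 IH2] := IH (rcons F p) b y sF' U yP.
rewrite IH1 -yF; split=> // allF; rewrite IH2 // andbT.
move: (allF); rewrite yF => /and3P[xa xb _].
have S := and_tree_supported P (rcons F p).
rewrite !(run_out _ S) // !y_out ?xa //.
  by apply: contraNneq bF => ->; rewrite mem_cat mem_rcons mem_head.
by apply: contraNneq aF => ->; rewrite mem_cat mem_rcons mem_head.
Qed.

(** Times are bounded through powers of 2, which avoids logarithms. The maximum over the wires is
    attained, so each wire can be checked separately. *)
Lemma gate_time_exp g (t : Q -> nat) C k :
  (forall q, q \in wires g -> 2 ^ (t q).+1 * k <= C) -> 2 ^ gate_time g t * k <= C.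
Proof.
move=> H; rewrite /gate_time.
have [q qg ->]: exists2 q, q \in wires g & \max_(q <- wires g) t q = t q.
  have: wires g != [::] by case: g {H}.
  elim: (wires g) => // a [|b s] IH _; rewrite big_cons.
    by exists a; rewrite ?mem_head // big_nil maxn0.
  have [//|q qs ->] := IH; case: (leqP (t a) (t q)) => _.
    by exists q => //; rewrite in_cons qs orbT.
  by exists a => //; rewrite mem_head.
exact: H.
Qed.

(* A bit consumed or written when [r] tree gates are still to come (itself
   included) is ready at time at most [log2 (C / r)]: halving [r] costs one
   layer, as in a balanced tree. *)
Lemma and_tree_time P F d (t : Q -> nat) C :
  size F = (size P).+1 -> uniq (F ++ P) ->
  (forall q, q \in F -> 2 ^ t q <= C) ->
  (forall j, j < size F -> 2 ^ (t (nth d F j)).+1 * (size P - j./2) <= C) ->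
  (forall i, i < size P -> 2 ^ (t (nth d P i)).+1 * (size P - i) <= C) ->
  (forall q, q \in F ++ P -> 2 ^ time (and_tree P F) t q <= C) /\
  (forall j, j < size (F ++ P) ->
     2 ^ time (and_tree P F) t (nth d (F ++ P) j) * (size P - j./2) <= C).
Proof.
elim: P F t => [|p P IH] F t.
  move=> sF _ tF _ _; rewrite cats0; split=> [q|j _]; last by rewrite muln0.
  by case: F sF tF => [|a []] //= _; apply.
case: F => [|a [|b F]] //= [sF] /and3P[aF bF U] tF tFj tPi.
set g := GateToffoli a b p; set u := sched g t.
move: aF bF U; rewrite inE negb_or -cat_rcons => /andP[ab aF] bF U.
have sF' : size (rcons F p) = (size P).+1 by rewrite size_rcons sF.
have pP : p \notin F ++ P.
  by move: U; rewrite cat_rcons -cat1s uniq_catCA /= => /andP[].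
have gT : 2 ^ gate_time g t * (size P).+1 <= C.
  apply: gate_time_exp => q; rewrite !inE => /or3P[] /eqP->.
  - exact: (tFj 0).
  - exact: (tFj 1).
  exact: (tPi 0).
have gT1 : 2 ^ gate_time g t <= C by apply: leq_trans gT; rewrite leq_pmulr.
have u_g q : q \in wires g -> u q = gate_time g t by rewrite /u /sched => ->.
have u_FP q : q \in F ++ P -> u q = t q.
  move=> qFP; rewrite /u /sched ifN //= !inE !negb_or.
  have sub : q \in rcons F p ++ P by rewrite cat_rcons -cat1s mem_cat mem_cat
    orbCA -mem_cat qFP orbT.
  apply/and3P; split; [move: aF|move: bF|move: pP]; apply: contraNneq => <- //.
have [|||IH1 IH2] := IH (rcons F p) u sF' U.
- move=> q; rewrite mem_rcons inE => /predU1P[->|qF].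
    by rewrite u_g // !inE eqxx !orbT.
  by rewrite u_FP ?mem_cat ?qF // tF // !inE qF !orbT.
- move=> j; rewrite size_rcons ltnS leq_eqVlt nth_rcons => /predU1P[->|jF].
    (* With [m = size P], the new bit stands at index [m] of the queue, and [2 * (m - m./2) <= m.+1]
       pays for the layer of the gate that consumes it. *)
    rewrite ltnn eqxx u_g ?inE ?eqxx ?orbT //; apply: leq_trans gT.
    by rewrite expnS -mulnA mulnCA leq_mul2l sF; lia.
  rewrite jF u_FP ?mem_cat ?mem_nth //.
  by have := tFj j.+2; rewrite /= !ltnS; apply.
- move=> i iP; rewrite u_FP ?mem_cat ?mem_nth ?orbT //.
  by have := tPi i.+1; rewrite /= subSS; apply.
have S := and_tree_supported P (rcons F p).
have out q : q \notin rcons F p ++ P -> q \in wires g ->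
    time (and_tree P (rcons F p)) u q = gate_time g t.
  by move=> qS qg; rewrite (time_out _ S) // u_g.
split=> [q|[|[|j]]].
- rewrite !inE => /or3P[/eqP->|/eqP->|/IH1//].
    by rewrite out // !inE eqxx.
  by rewrite out // !inE eqxx orbT.
- by rewrite /= subn0 out // !inE eqxx.
- by rewrite /= subn0 out // !inE eqxx orbT.
by rewrite /= !ltnS => /IH2.
Qed.

(** * One level: a tree followed by NOT gates *)

Definition not_layer N : circuit Q := [seq GateX q | q <- N].

Lemma run_not_layer N x q : uniq N -> run (not_layer N) x q = (q \in N) (+) x q.
Proof.
elim: N x => //= p N IH x /andP[pN U]; rewrite IH // ffunE inE.
by case: (q =P p) => [->|//]; rewrite (negPf pN).
Qed.

Lemma time_not_layer N t q : uniq N -> time (not_layer N) t q = (q \in N) + t q.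
Proof.
elim: N t => //= p N IH t /andP[pN U]; rewrite IH // /sched inE inE.
case: (q =P p) => [->|//]; rewrite (negPf pN) /gate_time /=.
by rewrite big_seq1.
Qed.

Lemma not_layer_props N :
  [/\ well_formed (not_layer N), all (@classical Q) (not_layer N),
      supported N (not_layer N) & toffoli_count (not_layer N) = 0].
Proof.
split; rewrite /well_formed /supported /toffoli_count.
- by rewrite all_map; apply/allP.
- by rewrite all_map; apply/allP.
- by rewrite all_map; apply/allP => q qN /=; rewrite qN.
by rewrite count_map; elim: N.
Qed.

(** [N] keeps the order of [F ++ P], and its time bound has the form assumed for [P], so levels can
    be chained. Of the factor 8, one 2 comes from the tree, one from the NOT layer, and one from [N]
    being twice as long as [P]. *)
Lemma and_level P F (t : Q -> nat) B d :
  size F = (size P).+1 -> uniq (F ++ P) -> 0 < B ->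
  (forall q, q \in F -> t q = 0) ->
  (forall i, i < size P -> 2 ^ t (nth d P i) * (size P - i) <= B) ->
  exists c a N,
    [/\ and_circuit P F c a,
        perm_eq (rcons N a) (F ++ P),
        (forall x, all (fun p => ~~ x p) P ->
           run c x a -> all (fun p => ~~ run c x p) N),
        2 ^ time c t a <= 2 * B &
        forall j, j < size N ->
          2 ^ time c t (nth d N j) * (size N - j) <= 8 * B].
Proof.
move=> sF U B0 tF tP.
have sFP : size (F ++ P) = (size P).*2.+1 by rewrite size_cat sF addSn addnn.
have [N [a eFP]]: exists N a, F ++ P = rcons N a.
  by case: (lastP (F ++ P)) sFP => // N a _; exists N, a.
have sN : size N = (size P).*2 by move: sFP; rewrite eFP size_rcons => -[].
have [aN UN]: a \notin N /\ uniq N.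
  by move: U; rewrite eFP rcons_uniq => /andP.
have [nl_wf nl_cl nl_supp nl_count] := not_layer_props N.
have k_le_B : size P <= B.
  case: (posnP (size P)) => [->//|P0]; apply: leq_trans (tP 0 P0).
  by rewrite subn0 leq_pmull ?expn_gt0.
have [||| t1 t2] := @and_tree_time P F d t (2 * B) sF U.
- by move=> q /tF->; lia.
- move=> j jF; rewrite tF ?mem_nth // expn1 leq_mul2l /=; lia.
- by move=> i iP; rewrite expnS -mulnA leq_mul2l tP.
exists (and_tree P F ++ not_layer N), a, N; rewrite eFP perm_refl; split=> //.
- split.
  + by rewrite well_formed_cat and_tree_wf.
  + by rewrite all_cat and_tree_classical.
  + rewrite supported_cat and_tree_supported eFP.
    by apply: sub_supported nl_supp => q; rewrite mem_rcons inE => ->; rewrite orbT.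
  + by rewrite eFP mem_rcons mem_head.
  + rewrite toffoli_count_cat nl_count addn0.
    by rewrite and_tree_count // sF.
  move=> x xP; rewrite run_cat run_not_layer // (negPf aN) /=.
  by have [] := and_treeP a sF U xP; rewrite eFP last_rcons.
- move=> x xP; rewrite run_cat run_not_layer // (negPf aN) /=.
  have [] := and_treeP a sF U xP; rewrite eFP last_rcons all_rcons => -> h /h.
  move=> /andP[_ /allP yN]; apply/allP => q qN /=.
  by rewrite run_not_layer // qN yN.
- by rewrite time_cat time_not_layer // (negPf aN) t1 // eFP mem_rcons mem_head.
move=> j jN; rewrite time_cat time_not_layer // mem_nth // expnS.
have := t2 j; rewrite eFP size_rcons nth_rcons jN ltnS => /(_ (ltnW jN)) h.
rewrite -mulnA -[8 * B]/((2 * 4) * B) -mulnA leq_mul2l /=.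
apply: leq_trans (_ : 2 * (2 * B) <= _); last by lia.
by apply: leq_trans (leq_mul (leqnn 2) h); rewrite mulnCA leq_mul2l; lia.
Qed.

(** * Recursion over the levels *)

Lemma and_circuit_mono P P' F c w :
  {subset P <= P'} -> and_circuit P F c w -> and_circuit P' F c w.
Proof.
move=> sP [wf cl supp out cnt val].
have sFP : {subset F ++ P <= F ++ P'}.
  by move=> q; rewrite !mem_cat => /orP[->//|/sP->]; rewrite orbT.
split=> // [||x /allP xP']; [exact: sub_supported supp|exact: sFP|].
by apply: val; apply/allP => q /sP/xP'.
Qed.

(** Numerically, [3 ^ 7 = 2187] exceeds [16 * 2 ^ 7 = 2048]. *)
Lemma leq_exp7 r s : 3 * r <= 2 * s -> 16 * r ^ 7 <= s ^ 7.
Proof.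
move=> rs; rewrite -(@leq_pmul2l (2 ^ 7)) // mulnA -expnMn.
apply: leq_trans (_ : (3 * r) ^ 7 <= _); last by rewrite leq_exp2r.
by rewrite expnMn leq_mul2r; apply/orP; right.
Qed.

(* If the first level fails ([a] is false), the bits of [N] are dirty and [w] is
   arbitrary, but then the final Toffoli gate leaves [z] at 0 anyway. *)
Lemma and_circuit_combine P z N F F' c d a w :
  0 < size F -> 0 < size F' -> uniq ((F ++ F') ++ rcons P z) ->
  and_circuit P F c a -> perm_eq (rcons N a) (F ++ P) ->
  (forall x, all (fun p => ~~ x p) P ->
     run c x a -> all (fun p => ~~ run c x p) N) ->
  and_circuit N F' d w ->
  and_circuit (rcons P z) (F ++ F') (c ++ d ++ [:: GateToffoli a w z]) z.
Proof.
move=> F0 F'0 U cP eN cN dP.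
have eL : perm_eq [:: z, a & F' ++ N] ((F ++ F') ++ rcons P z).
  apply/seq.permP=> p; have /seq.permP/(_ p) := eN.
  by rewrite -!cats1 /= !count_cat /=; lia.
have /= /and3P[] : uniq [:: z, a & F' ++ N] by rewrite (perm_uniq eL).
rewrite inE negb_or => /andP[za zNF] aNF UNF.
have wNF := and_out dP.
have aw : a != w by apply: contraNneq aNF => ->.
have zw : z != w by apply: contraNneq zNF => ->.
have memL q : q \in [:: z, a & F' ++ N] -> q \in (F ++ F') ++ rcons P z.
  by rewrite (perm_mem eL).
have zFP : z \notin F ++ P.
  by rewrite -(perm_mem eN) mem_rcons inE negb_or za; move: zNF;
     rewrite mem_cat negb_or => /andP[].
split.
- rewrite !well_formed_cat (and_wf cP) (and_wf dP) /= !inE negb_or aw.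
  by rewrite eq_sym za eq_sym zw.
- by rewrite !all_cat (and_classical cP) (and_classical dP).
- rewrite !supported_cat; apply/and3P; split.
  + apply: sub_supported (and_supported cP) => q.
    rewrite !mem_cat mem_rcons inE => /orP[] ->; rewrite ?orbT //.
  + apply: sub_supported (and_supported dP) => q qNF; apply: memL.
    by rewrite !inE qNF !orbT.
  rewrite /supported /= !memL // !inE ?eqxx ?orbT //.
  by rewrite wNF !orbT.
- by rewrite mem_cat mem_rcons mem_head orbT.
- rewrite !toffoli_count_cat (and_count cP) (and_count dP) size_cat /=.
  by move: F0 F'0; clear; lia.
move=> x; rewrite all_rcons => /andP[xz xP].
rewrite !run_cat /= ffunE eqxx.
rewrite (run_out _ (and_supported dP) zNF) (run_out _ (and_supported cP) zFP).
rewrite (run_out _ (and_supported dP) aNF) (negPf xz) all_cat /=.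
have [ya|/negPf ya] := boolP (run c x a); last first.
  by rewrite -(and_val cP) // ya.
rewrite -(and_val cP) // ya (and_val dP) ?cN //=.
(* The first level does not touch [F'], so [d] still sees its initial values. *)
apply: eq_in_all => q qF'; apply: run_out (and_supported cP) _.
move: UNF; rewrite cat_uniq => /and3P[_ /hasPn F'N _].
rewrite -(perm_mem eN) mem_rcons inE negb_or; apply/andP; split.
  by apply: contraNneq aNF => <-; rewrite mem_cat qF'.
by apply/negP => /F'N; rewrite /= qF'.
Qed.

(* The exponent 7 comes from [(3 / 2) ^ 7 >= 16]: a level multiplies the number
   of clean bits by at least 3/2, the bound [B] by 8, and the final gate that
   combines the level with the rest costs a further factor 2. *)
Lemma and_circuit_exists P F (t : Q -> nat) B d :
  0 < size F -> size F <= (size P).+1 \/ 4 <= size P ->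
  uniq (F ++ P) -> 0 < B -> (forall q, q \in F -> t q = 0) ->
  (forall i, i < size P -> 2 ^ t (nth d P i) * (size P - i) <= B) ->
  exists c w, and_circuit P F c w /\
    forall q, q \in F ++ P ->
      2 ^ time c t q * maxn 1 (size P) ^ 7 <= 8 * B * (size F + size P) ^ 7.
Proof.
have [m] := ubnP (size F); elim: m => // m IH in P F t B *.
rewrite ltnS => Fm F0 sFP U B0 tF tP.
have tP1 q : q \in P -> 2 ^ t q <= B.
  move=> qP; have iP: index q P < size P by rewrite index_mem.
  have := tP _ iP; rewrite nth_index // => h; apply: leq_trans h.
  by rewrite leq_pmulr // subn_gt0.
have max7 : maxn 1 (size P) ^ 7 <= (size F + size P) ^ 7.
  by rewrite leq_exp2r //; lia.
have finish T : 2 ^ T <= 8 * B ->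
    2 ^ T * maxn 1 (size P) ^ 7 <= 8 * B * (size F + size P) ^ 7.
  by move=> h; apply: leq_mul.
(* With this few controls one level suffices; it uses only [size F - 1] of the clean bits. *)
have [sF|sF] := leqP (size F) (size P).+1.
  set P0 := take (size F).-1 P.
  have sP0' : size P0 = (size F).-1 by rewrite size_takel //; lia.
  have sP0 : size F = (size P0).+1 by lia.
  have sPP : subseq (F ++ P0) (F ++ P) by rewrite cat_subseq ?take_subseq.
  have [|c [a [N [cP eN _ ta tN]]]] :=
    @and_level P0 F t B d sP0 (subseq_uniq sPP U) B0 tF.
    move=> i iP0; rewrite nth_take; last by rewrite -sP0'.
    apply: leq_trans (tP i _); last by lia.
    by rewrite leq_mul2l leq_sub2r ?orbT //; lia.
  exists c, a; split; first by apply: and_circuit_mono cP => q /mem_take.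
  move=> q qFP; apply: finish.
  have [|qP0] := boolP (q \in F ++ P0).
    rewrite -(perm_mem eN) mem_rcons inE => /predU1P[->|qN]; first lia.
    have iN : index q N < size N by rewrite index_mem.
    have := tN _ iN; rewrite nth_index // => h; apply: leq_trans h.
    by rewrite leq_pmulr // subn_gt0.
  rewrite (time_out _ (and_supported cP)) //.
  move: qP0 qFP; rewrite !mem_cat => /norP[/negPf-> _] /= /tP1; lia.
have sP : 4 <= size P by case: sFP; lia.
(* The last clean bit has the weakest time bound and is needed only by the final gate, so it is the
   one set aside. *)
have [P0 [z eP]]: exists P0 z, P = rcons P0 z.
  by case: (lastP P) sP => // P0 z _; exists P0, z.
have sPS : size P = (size P0).+1 by rewrite eP size_rcons.
set F1 := take (size P) F; set F2 := drop (size P) F.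
have eF : F = F1 ++ F2 by rewrite cat_take_drop.
have sF1 : size F1 = (size P0).+1 by rewrite size_takel //; lia.
have sF2 : size F = size P + size F2 by rewrite size_drop; lia.
have U' : uniq ((F1 ++ F2) ++ rcons P0 z) by rewrite -eF -eP.
have [|||c [a [N [cP eN cN ta tN]]]] := @and_level P0 F1 t B d sF1 _ B0.
- apply: subseq_uniq U'; rewrite -cats1 -catA cat_subseq //.
  apply: subseq_trans (suffix_subseq F2 _); exact: prefix_subseq.
- by move=> q qF1; apply: tF; rewrite eF mem_cat qF1.
- move=> i iP0; have := tP i; rewrite eP size_rcons nth_rcons iP0 => /(_ (ltnW iP0)).
  by apply: leq_trans; rewrite leq_mul2l leq_sub2r ?orbT.
have sN : size N = (size P0).*2.
  by have := perm_size eN; rewrite size_rcons size_cat sF1 addSn addnn => -[].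
have eL : perm_eq [:: z, a & F2 ++ N] (F ++ P).
  rewrite eF eP; apply/seq.permP=> p; have /seq.permP/(_ p) := eN.
  by rewrite -!cats1 /= !count_cat /=; lia.
have /= /and3P[] : uniq [:: z, a & F2 ++ N] by rewrite (perm_uniq eL).
rewrite inE negb_or => /andP[za zFN] aFN UFN.
have memL q : (q \in F ++ P) = [|| q == z, q == a | q \in F2 ++ N].
  by rewrite -(perm_mem eL) !inE.
have offc q : q \in F2 -> q \notin F1 ++ P0.
  move=> qF2; rewrite -(perm_mem eN) mem_rcons inE negb_or; apply/andP; split.
    by apply: contraNneq aFN => <-; rewrite mem_cat qF2.
  move: UFN; rewrite cat_uniq => /and3P[_ /hasPn FN _].
  by apply/negP => /FN; rewrite /= qF2.
have [|||||||e [w [eP' te]]] := IH N F2 (time c t) (8 * B).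
- by lia.
- by lia.
- by right; lia.
- by [].
- by lia.
- by move=> q qF2; rewrite (time_out _ (and_supported cP)) ?offc // tF // eF mem_cat qF2 orbT.
- exact: tN.
exists (c ++ e ++ [:: GateToffoli a w z]), z; split.
  by rewrite eP eF; apply: and_circuit_combine cN eP' => //; lia.
(* A level loses only [a] and [z], so the total of controls and clean bits does not grow. From
   [4 <= size P], the size [2 * (size P - 1)] of [N] is at least 3/2 that of [P]. *)
have eSS : size F2 + size N <= size F + size P by lia.
have s16 : 16 * size P ^ 7 <= maxn 1 (size N) ^ 7 by apply: leq_exp7; lia.
have -> : maxn 1 (size P) = size P by lia.
have te' q : q \in F2 ++ N -> 2 ^ (time e (time c t) q).+1 * size P ^ 7
    <= 8 * B * (size F + size P) ^ 7.
  move=> /te h; rewrite -(@leq_pmul2l 8) // expnS.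
  have h' : 2 ^ time e (time c t) q * (16 * size P ^ 7)
      <= 8 * (8 * B) * (size F + size P) ^ 7.
    apply: leq_trans (leq_trans (leq_mul (leqnn _) s16) h) _.
    by rewrite leq_mul2l leq_exp2r ?eSS ?orbT.
  by move: h'; lia.
have z_out : time e (time c t) z = t z.
  rewrite (time_out _ (and_supported eP')) // (time_out _ (and_supported cP)) //.
  rewrite -(perm_mem eN) mem_rcons inE negb_or za.
  by apply: contra zFN => zN; rewrite mem_cat zN orbT.
have finish' T : 2 ^ T <= 2 * B ->
    2 ^ T.+1 * size P ^ 7 <= 8 * B * (size F + size P) ^ 7.
  move=> h; apply: leq_mul; first by rewrite expnS; lia.
  by rewrite leq_exp2r; lia.
have gT : 2 ^ gate_time (GateToffoli a w z) (time e (time c t)) * size P ^ 7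
    <= 8 * B * (size F + size P) ^ 7.
  apply: gate_time_exp => q; rewrite !inE => /or3P[] /eqP->.
  - by rewrite (time_out _ (and_supported eP')) // finish'.
  - exact/te'/(and_out eP').
  by rewrite z_out finish' //; have := tP1 z; rewrite eP mem_rcons mem_head; lia.
move=> q qFP; rewrite !time_cat /= /sched; case: ifP => // /negbT.
rewrite !inE !negb_or => /and3P[/negPf qa _ /negPf qz].
move: qFP; rewrite memL qa qz /= => /te'; apply: leq_trans.
by rewrite leq_mul2r leq_exp2l ?leqnSn ?orbT.
Qed.

End AndCircuits.

(** * The top level with two ancillas *)

Section TwoBits.
Local Open Scope nat_scope.
Variable Q : finType.
Implicit Types (c : circuit Q) (x : basis Q) (P F : seq Q).

(** Unlike in the recursion, no clean bit is set aside for the conjunction of [a] and [w]: a Toffoli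
    gate onto the target will take it. This saves one Toffoli gate here. *)
Lemma and_of_two_circuit P F :
  size P = 2 -> 2 <= size F -> uniq (F ++ P) ->
  exists c a w,
    [/\ well_formed c, all (@classical Q) c, supported (F ++ P) c,
        toffoli_count c = size F - 2 &
    [/\ uniq [:: a; w], {subset [:: a; w] <= F ++ P},
        (forall x, all (fun p => ~~ x p) P ->
           run c x a && run c x w = all x F) &
        forall q, 2 ^ time c (fun=> 0) q <= 128 * (size F).+1 ^ 7]].
Proof.
move=> sP F2 U; have [d _] : exists d, d \in F by case: (F) F2 => // d; exists d; apply: mem_head.
(* The first tree has [k] gates and takes [k + 1] controls, leaving at least one control for [w]. *)
pose k := minn 2 (size F - 2).
have k2 : k <= 2 by rewrite geq_minl.
have kF : k.+1 < size F by rewrite /k; lia.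
pose P0 := take k P; pose F1 := take k.+1 F; pose F' := drop k.+1 F.
have eF : F = F1 ++ F' by rewrite cat_take_drop.
have sP0 : size P0 = k by rewrite size_takel // sP.
have sF1 : size F1 = (size P0).+1 by rewrite size_takel ?sP0 // ltnW.
have sF' : size F' = size F - k.+1 by rewrite size_drop.
have sub : subseq (F1 ++ F' ++ P0) (F ++ P).
  by rewrite catA -eF cat_subseq // take_subseq.
have U' := subseq_uniq sub U.
(* At time 0 the bound [B = 2] holds because [k <= 2]. The next level then has bound [8 * 2 = 16],
   and the final constant is [8 * 16 = 128]. *)
have [||||c [a [N [cP eN cN ta tN]]]] := @and_level _ P0 F1 (fun=> 0) 2 d sF1.
- by apply: subseq_uniq U'; rewrite cat_subseq // suffix_subseq.
- by [].
- by [].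
- by move=> i _; rewrite sP0; lia.
have sN : size N = k.*2.
  by have := perm_size eN; rewrite size_rcons size_cat sF1 sP0 addSn addnn => -[].
have eL : perm_eq (a :: F' ++ N) (F1 ++ F' ++ P0).
  apply/seq.permP=> p; have /seq.permP/(_ p) := eN.
  by rewrite -!cats1 /= !count_cat /=; lia.
have /= /andP[aFN UFN] : uniq (a :: F' ++ N) by rewrite (perm_uniq eL).
have offc q : q \in F' -> q \notin F1 ++ P0.
  move=> qF; rewrite -(perm_mem eN) mem_rcons inE negb_or; apply/andP; split.
    by apply: contraNneq aFN => <-; rewrite mem_cat qF.
  move: UFN; rewrite cat_uniq => /and3P[_ /hasPn FN _].
  by apply/negP => /FN; rewrite /= qF.
have memL q : q \in a :: F' ++ N -> q \in F ++ P.
  by rewrite (perm_mem eL); apply: mem_subseq.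
have [|||||e [w [eP te]]] :=
  @and_circuit_exists _ N F' (time c (fun=> 0)) 16 d _ _ UFN.
- by rewrite sF'; lia.
(* Either [k = 2] and [N] has four bits, or a single control is left. *)
- by rewrite sF' sN /k; lia.
- by [].
- by move=> q qF; rewrite (time_out _ (and_supported cP)) ?offc.
- exact: tN.
have sup : supported (F ++ P) (c ++ e).
  rewrite supported_cat; apply/andP; split.
    apply: sub_supported (and_supported cP) => q; rewrite -(perm_mem eN).
    rewrite mem_rcons => qN; apply: memL; move: qN.
    by rewrite !inE mem_cat => /orP[]->; rewrite ?orbT.
  apply: sub_supported (and_supported eP) => q qN; apply: memL.
  by rewrite inE qN orbT.
exists (c ++ e), a, w; split=> //.
- by rewrite well_formed_cat (and_wf cP) (and_wf eP).
- by rewrite all_cat (and_classical cP) (and_classical eP).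
- rewrite toffoli_count_cat (and_count cP) (and_count eP) sF1 sP0 sF'; lia.
split.
- rewrite /= inE andbT; apply: contraNneq aFN => ->; exact: and_out eP.
- move=> q; rewrite !inE => /orP[]/eqP->; apply: memL; first exact: mem_head.
  by rewrite inE (and_out eP) orbT.
- move=> x /allP xP.
  have xP0 : all (fun p => ~~ x p) P0 by apply/allP => q /mem_take/xP.
  rewrite !run_cat (run_out _ (and_supported eP) aFN) [in RHS]eF all_cat.
  have [ya|/negPf ya] := boolP (run c x a); last first.
    by rewrite -(and_val cP) // ya.
  rewrite -(and_val cP) // ya (and_val eP) ?cN //=.
  by apply: eq_in_all => q qF'; apply: run_out (and_supported cP) _; apply: offc.
move=> q; rewrite time_cat.
have F7 : 0 < (size F).+1 ^ 7 by rewrite expn_gt0.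
have [/te h|qFN] := boolP (q \in F' ++ N).
  apply: leq_trans (leq_trans h _).
    by rewrite leq_pmulr // expn_gt0 leq_max.
  by rewrite -[8 * 16]/128 leq_mul2l /= leq_exp2r // sF' sN; lia.
rewrite (time_out _ (and_supported eP)) //.
have [->|qa] := eqVneq q a.
  by apply: leq_trans ta _; rewrite -[2 * 2]/4; lia.
rewrite (time_out _ (and_supported cP)) ?muln_gt0 //.
rewrite -(perm_mem eN) mem_rcons inE negb_or qa.
by apply: contra qFN; rewrite mem_cat orbC => ->.
Qed.

End TwoBits.

(** * From bits to quantum states *)

Section Quantum.
Variable R : realType.

Lemma lin_ext_ket (P Q : finType) (f : basis P -> state R Q) x :
  lin_ext f (ket R x) = f x.
Proof.
rewrite /lin_ext (bigD1 x) //= ffunE eqxx scale1r big1 ?addr0 // => y /negPf yx.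
by rewrite ffunE yx scale0r.
Qed.

Lemma eq_lin_ext (P Q : finType) (f g : basis P -> state R Q) psi :
  f =1 g -> lin_ext f psi = lin_ext g psi.
Proof. by move=> fg; apply: eq_bigr => x _; rewrite fg. Qed.

Lemma lin_ext_comp (P Q S : finType) (g : basis Q -> state R S)
    (f : basis P -> state R Q) psi :
  lin_ext g (lin_ext f psi) = lin_ext (fun x => lin_ext g (f x)) psi.
Proof.
rewrite /lin_ext; under [RHS]eq_bigr do rewrite scaler_sumr.
rewrite exchange_big; apply: eq_bigr => y _ /=.
rewrite sum_ffunE scaler_suml; apply: eq_bigr => x _.
by rewrite ffunE scalerA.
Qed.

Lemma circuit_op_lin_ext (P Q : finType) (c : circuit Q)
    (f : basis P -> state R Q) psi :
  circuit_op c (lin_ext f psi) = lin_ext (fun x => circuit_op c (f x)) psi.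
Proof. by elim: c f => //= g c IH f; rewrite /gate_op lin_ext_comp IH. Qed.

Lemma circuit_op_ket (Q : finType) (c : circuit Q) x :
  all (@classical Q) c -> circuit_op c (ket R x) = ket R (run c x).
Proof.
elim: c x => //= g c IH x /andP[gc cc]; rewrite -IH // /gate_op lin_ext_ket.
by congr foldl; case: g gc.
Qed.

(** By linearity it suffices to follow basis states, on which a classical circuit acts as [run]. *)
Lemma implements_classical (Q A : finType) (c : circuit (Q + A)%type)
    (f : basis Q -> basis Q) :
  let clean (x : basis Q) : basis (Q + A)%type :=
    [ffun q : Q + A => if q is inl p then x p else false] in
  all (@classical _) c -> (forall x, run c (clean x) = clean (f x)) ->
  implements_with_clean c (lin_ext (fun x => ket R (f x))).
Proof.
move=> clean cc cP psi; rewrite /add_clean circuit_op_lin_ext lin_ext_comp.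
by apply: eq_lin_ext => x; rewrite circuit_op_ket // cP lin_ext_ket.
Qed.

End Quantum.

(** * The logarithmic bound and the final circuit *)

Lemma exp2_le_log (R : realType) (D n : nat) :
  (2 <= n)%N -> (2 ^ D <= 128 * n.+1 ^ 7)%N ->
  (D.*2.+1)%:R <= 43%:R * log2 (n%:R : R).
Proof.
move=> n2 hD; have ln2 : 0 < ln (2 : R) by rewrite ln_gt0 // ltr1n.
have n0 : (0 < n)%N by apply: leq_trans n2.
have lnn : ln (2 : R) <= ln (n%:R : R).
  by rewrite ler_ln ?posrE ?ltr0n // ler_nat.
rewrite /log2 mulrA ler_pdivlMr //.
(* This uses [n + 1 <= n ^ 2], valid for [n >= 2]. *)
have hD' : (2 ^ D <= 2 ^ 7 * n ^ 14)%N.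
  apply: (leq_trans hD); rewrite leq_mul2l (expnM n 2 7) leq_exp2r //.
  by apply/orP; right; nia.
have : ln (2 ^+ D : R) <= ln (2 ^+ 7 * n%:R ^+ 14 : R).
  rewrite ler_ln ?posrE ?mulr_gt0 ?exprn_gt0 ?ltr0n //.
  by rewrite -!natrX -natrM ler_nat.
rewrite lnM ?posrE ?exprn_gt0 ?ltr0n // !lnXn ?ltr0n // => h.
(* Doubling [h] and adding [ln 2] gives [15 * ln 2 + 28 * ln n], at most [43 * ln n] since
   [ln 2 <= ln n]. *)
have -> : (D.*2.+1)%:R = 2 * D%:R + 1 :> R.
  by rewrite -addn1 natrD -muln2 natrM mulrC.
move: h; rewrite -(mulr_natr _ D) -(mulr_natr _ 7) -(mulr_natr _ 14).
move: (ln 2) (ln n%:R) ln2 lnn => u v u0 uv h; nra.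
Qed.

Theorem mainTheorem1 (R : realType) :
  exists C : R, 0 < C /\
    forall n : nat, (2 <= n)%N ->
      exists c : circuit (('I_n + unit) + 'I_2)%type,
        [/\ well_formed c,
            implements_with_clean c (@mcx R n),
            toffoli_count c = (2 * n - 3)%N &
            (depth c)%:R <= C * log2 n%:R].
Proof.
exists 43%:R; split=> [|n n2]; first by rewrite ltr0n.
pose control i : ('I_n + unit) + 'I_2 := inl (inl i).
pose target : ('I_n + unit) + 'I_2 := inl (inr tt).
pose F := [seq control i | i <- enum 'I_n].
pose P : seq (('I_n + unit) + 'I_2) := [seq inr i | i <- enum 'I_2].
have sF : size F = n by rewrite size_map size_enum_ord.
have sP : size P = 2 by rewrite size_map size_enum_ord.
have FP0 : target \notin F ++ P.
  by rewrite mem_cat; apply/norP; split; apply/mapP=> -[].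
have U : uniq (F ++ P).
  have cI : injective control by move=> ? ? [].
  have iI : injective (inr : 'I_2 -> ('I_n + unit) + 'I_2) by move=> ? ? [].
  rewrite cat_uniq (map_inj_uniq cI) (map_inj_uniq iI) !enum_uniq andbT.
  by apply/hasPn => _ /mapP[i _ ->]; apply/mapP=> -[].
have F2 : (2 <= size F)%N by rewrite sF.
have [c [a [w [wf cl sup cnt [aw awFP val tm]]]]] :=
  and_of_two_circuit sP F2 U.
rewrite sF in cnt tm.
pose toff := GateToffoli a w target.
(* The largest exponent allowed by [tm], hence a bound on the time of every qubit. *)
pose D := trunc_log 2 (128 * n.+1 ^ 7).
have cD : has_layering c D.
  apply: time_layering => q; apply: trunc_log_max => //; exact: tm.
have toff1 : has_layering [:: toff] 1.
  apply: time_layering => q /=; rewrite /sched /gate_time big1_seq //.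
  by case: ifP.
(* The Toffoli count is [(n - 2) + 1 + (n - 2) = 2 * n - 3], and [D + 1 + D] layers suffice. *)
exists (c ++ [:: toff] ++ rev c); split.
- rewrite !well_formed_cat wf.
  have -> : well_formed (rev c) by rewrite /well_formed all_rev.
  rewrite /= andbT.
  rewrite andbT; move: aw => /= /andP[+ _]; rewrite !inE => aw.
  by rewrite negb_or aw; apply/and3P; split => //;
    apply: contraNneq FP0 => <-; apply: awFP; rewrite !inE eqxx ?orbT.
- apply: implements_classical.
    by rewrite !all_cat all_rev cl.
  move=> x; set y := [ffun _ => _]; rewrite !run_cat /=.
  have yP : all (fun p => ~~ y p) P.
    by apply/allP => _ /mapP[i _ ->]; rewrite ffunE.
  have yF : all y F = [forall i, x (inl i)].
    have yc i : y (control i) = x (inl i) by rewrite ffunE.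
    apply/allP/forallP => [h i|h _ /mapP[i _ ->]]; last by rewrite yc.
    by rewrite -yc h // map_f // mem_enum.
  rewrite val // yF (run_out _ sup FP0) -(run_upd _ _ sup FP0) run_revK //.
  apply/ffunP=> q; rewrite !ffunE.
  by case: q => [[i|[]]|i]; rewrite ?ffunE.
- rewrite !toffoli_count_cat cnt [toffoli_count (rev c)]count_rev.
  rewrite [count _ c]cnt /=; lia.
have hD : (2 ^ D <= 128 * n.+1 ^ 7)%N.
  by rewrite trunc_logP // muln_gt0 expn_gt0.
apply: le_trans (exp2_le_log R n2 hD); rewrite ler_nat; apply: depth_le.
rewrite -addnn -addnS; apply: (has_layering_cat (E := 1 + D) cD).
exact: has_layering_cat toff1 (has_layering_rev cD).
Qed.
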